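(* Let $I\subset\mathbb{R}$ be a non-degenerate interval, let $f_n: I\to I$ be a $C^{1}$ map for each $n\geq 0$, and let $x_0\in I$, with orbit $\{x_k\}_{k=0}^{\infty}$ given by $x_{k+1}=f_k(x_k)$, $k\ge 0$. Assume that $\{f_n'\}_{n=0}^{\infty}$ is equi-continuous in $I$, and that $M:=\inf\{|f_n'(x_k)| : n,k\geq 0\}>0$. If $\lambda(x_0)>0$, where $\lambda(x_0)$ is the Lyapunov exponent at $x_0$, then the non-autonomous system $x_{n+1}=f_n(x_n)$, $n\geq 0$, is strongly sensitive at $x_0$.
   Context: Write $f_0^n:=f_{n-1}\circ\cdots\circ f_0$ for $n\ge 1$ and $f_0^0=\mathrm{id}$, so that the orbit of $x_0$ is $x_n=f_0^n(x_0)$. Equi-continuity: a sequence of uniformly continuous maps $h_n: I\to\mathbb{R}$, $n\ge 0$, is equi-continuous in $I$ if for any $\epsilon>0$ there exists $\delta>0$ such that $|h_n(x)-h_n(y)|<\epsilon$ for all $n\ge 0$ and all $x,y\in I$ with $|x-y|<\delta$. Lyapunov exponent at $x_0$: $\lambda(x_0):=\limsup_{n\to\infty}\frac1n\ln|(f_0^n)'(x_0)|=\limsup_{n\to\infty}\frac1n\sum_{k=0}^{n-1}\ln|f_k'(x_k)|$. Strong sensitivity at a point: with $x_0\in I$ (which is not an isolated point of $I$), the system is strongly sensitive at $x_0$ if there exist $\delta>0$ and a neighborhood $U$ of $x_0$ in $I$ such that for every $y_0\in U$ with $y_0\ne x_0$, $|f_0^N(y_0)-f_0^N(x_0)|>\delta$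 for some positive integer $N$. *)

(* Defs.v *)
From mathcomp Require Import all_boot all_order all_algebra.
From mathcomp Require Import all_classical all_reals all_analysis.

Set Implicit Arguments.
Unset Strict Implicit.
Unset Printing Implicit Defensive.

Import Order.TTheory GRing.Theory Num.Theory.
Import numFieldNormedType.Exports.

Local Open Scope classical_set_scope.
Local Open Scope ring_scope.

(* Self-maps of a set I are total functions R -> R that send I to I; every
   notion below only depends on their values on I. *)

Definition diff_quotient (R : realType) (g : R -> R) (x y : R) : R :=
  (g y - g x) / (y - x).

(* y tends to x within I `\ x, so the derivative is one-sided at an endpoint
   belonging to I. *)
Definition derivable_in (R : realType) (I : set R) (g : R -> R) (x : R) : Prop :=
  cvg (diff_quotient g x @ within I x^').

Definition derive_in (R : realType) (I : set R) (g : R -> R) (x : R) : R :=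
  lim (diff_quotient g x @ within I x^').

Definition C1_in (R : realType) (I : set R) (g : R -> R) : Prop :=
  (forall x, I x -> derivable_in I g x) /\ {within I, continuous (derive_in I g)}.

(* Library equicontinuity is pointwise; here delta is uniform over I (so each
   h n is in particular uniformly continuous on I). *)
Definition equi_continuous (R : realType) (I : set R) (h : nat -> R -> R) : Prop :=
  forall eps : R, 0 < eps -> exists2 delta : R, 0 < delta &
    forall (n : nat) (x y : R), I x -> I y -> `|x - y| < delta ->
      `|h n x - h n y| < eps.

Fixpoint iter_comp (R : realType) (f : nat -> R -> R) (n : nat) : R -> R :=
  if n is m.+1 then f m \o iter_comp f m else id.

(* lne 0 = -oo; the index n = 0 is irrelevant to the limsup. *)
Definition lyapunov_exponent (R : realType) (I : set R) (f : nat -> R -> R)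
    (x0 : R) : \bar R :=
  limn_esup (fun n : nat =>
    ((n%:R^-1 : R)%:E * lne (`|derive_in I (iter_comp f n) x0|%:E))%E).

Definition strongly_sensitive_at (R : realType) (I : set R) (f : nat -> R -> R)
    (x0 : R) : Prop :=
  [/\ I x0, ~ isolated I x0 &
    exists2 delta : R, 0 < delta &
    exists U : set R, [/\ U `<=` I, within I (nbhs x0) U &
      forall y0, U y0 -> y0 != x0 ->
        exists2 N : nat, (0 < N)%N &
          `|iter_comp f N y0 - iter_comp f N x0| > delta]].

(* Main.v *)
Require Import Defs.
From mathcomp Require Import all_boot all_order all_algebra.
From mathcomp Require Import all_classical all_reals all_analysis.
From mathcomp Require Import ring lra.

Import Order.TTheory GRing.Theory Num.Theory.
Import numFieldNormedType.Exports.
Local Open Scope classical_set_scope.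
Local Open Scope ring_scope.

(** Why the theorem holds.  Suppose that the orbit y_n of a point y_0 <> x_0
    stays within a small distance d of the orbit x_n for ever.  The mean value
    theorem on I writes y_(n+1) - x_(n+1) as f_n'(z) (y_n - x_n) with z between
    x_n and y_n.  By equicontinuity f_n'(z) is as close to f_n'(x_n) as desired,
    uniformly in n, and since |f_n'(x_n)| >= M > 0 this absolute error is also a
    small relative one: |f_n'(z)| >= q |f_n'(x_n)| for any q < 1 fixed in
    advance.  Multiplying, and recognizing the chain rule for f_0^n,
    |y_n - x_n| >= q^n |(f_0^n)'(x_0)| |y_0 - x_0|
    ([orbit_gap_lower_bound] and [derive_in_iter_comp]).

    A positive Lyapunov exponent gives c > 0 and infinitely many n with
    |(f_0^n)'(x_0)| > exp(c n) ([limn_esup_ln_gt0_growth]).  With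
    q = exp(- c / 2) the gap exceeds exp(c n / 2) |y_0 - x_0| for these n, which
    eventually passes d: a contradiction.  The choice of q, hence of d, involves
    c, M and the modulus of equicontinuity but not y_0, as strong sensitivity
    demands.

    Derivatives are limits of difference quotients within I, so one-sided at an
    endpoint of I.  The interval structure makes every point of I a limit point
    of I, which is what makes these limits unique ([interval_limit_point]).
    Along the orbit no derivative vanishes, which makes the chain rule
    elementary ([chain_rule_in]). *)

(** * Derivatives within a set *)

Lemma interval_limit_point (R : realType) (I : set R) (x : R) :
  is_interval I -> (exists a b : R, [/\ I a, I b & a < b]) -> I x ->
  limit_point I x.
Proof.
move=> I_itv [a [b [Ia Ib ab]]] Ix.
have [p Ip px] : exists2 p, I p & p != x.
  have [ax|ax] := eqVneq a x; last by exists a.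
  by exists b => //; rewrite -ax gt_eqF.
move=> U /nbhs_ballP[e /= e0 xeU].
have d0 : 0 < `|p - x| by rewrite normr_gt0 subr_eq0.
pose t := Num.min 1 (e / 2 / `|p - x|).
have t0 : 0 < t by rewrite lt_min ltr01 /= !divr_gt0.
have t1 : t <= 1 by rewrite ge_min lexx.
have te : t * `|p - x| < e.
  apply: (@le_lt_trans _ _ (e / 2)); last lra.
  by rewrite -ler_pdivlMr// ge_min lexx orbT.
exists (x + t * (p - x)); split.
- by rewrite -subr_eq0 addrAC subrr add0r mulf_neq0 ?subr_eq0 ?(lt0r_neq0 t0).
- have [xp|xp] := leP x p.
  + by apply: (I_itv x p) => //; apply/andP; split; nra.
  + by apply: (I_itv p x) => //; apply/andP; split; nra.
- apply: xeU; rewrite /ball /= opprD addrA subrr add0r normrN normrM.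
  by rewrite gtr0_norm.
Qed.

Lemma within_dnbhs_proper (R : realType) (I : set R) (x : R) :
  limit_point I x -> ProperFilter (within I x^').
Proof.
move=> Ix; split; last exact: within_filter.
rewrite /within /= => -[/= e e0 xe].
have [y [yx Iy xy]] := Ix _ (nbhsx_ballx x e e0).
exact: (xe y).
Qed.

Lemma derive_in_eq (R : realType) (I : set R) (g : R -> R) (x l : R) :
  limit_point I x -> diff_quotient g x @ within I x^' --> l ->
  derive_in I g x = l.
Proof. by move=> /within_dnbhs_proper ? gl; apply/cvg_lim. Qed.

(** The usual g y = g x + (difference quotient) * (y - x), first on the
    punctured filter; the value at x itself is in every neighborhood of g x. *)
Lemma derivable_in_continuous (R : realType) (I : set R) (g : R -> R) (x : R) :
  derivable_in I g x -> g @ within I (nbhs x) --> g x.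
Proof.
move=> dg.
have g_punctured : g @ within I x^' --> g x.
  have -> : g x = g x + derive_in I g x * (x - x) by rewrite subrr mulr0 addr0.
  have : (fun y => g x + diff_quotient g x y * (y - x)) @ within I x^' -->
         g x + derive_in I g x * (x - x).
    apply: cvgD; first exact: cvg_cst.
    apply: cvgM => //; apply: cvg_within_filter.
    apply: cvgB; last exact: cvg_cst.
    exact: cvg_within.
  apply: cvg_trans; apply: near_eq_cvg.
  rewrite /within /= !near_withinE; near=> y => yx _.
  by rewrite /diff_quotient divfK ?subr_eq0// addrC subrK.
move=> U gU; have := g_punctured _ gU.
rewrite /= /nbhs /= /within /= near_withinE => gU'.
move: gU'; apply: filterS => y gUy Iy.
have [->|yx] := eqVneq y x; first exact: nbhs_singleton gU.
exact: gUy.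
Unshelve. all: by end_near. Qed.

(** As g'(x) is nonzero, g y differs from g x for y near x, so that the
    difference quotient of f \o g is the product of those of f and g, with no
    division by zero, and g tends to g x within I minus g x.  That second fact
    fails in general when g'(x) = 0. *)
Lemma chain_rule_in (R : realType) (I : set R) (f g : R -> R) (x : R) :
  limit_point I x -> set_fun I I g ->
  derivable_in I g x -> derivable_in I f (g x) -> derive_in I g x != 0 ->
  derivable_in I (f \o g) x /\
  derive_in I (f \o g) x = derive_in I f (g x) * derive_in I g x.
Proof.
move=> Ix gI dg df dg0.
suff fg : diff_quotient (f \o g) x @ within I x^' -->
          derive_in I f (g x) * derive_in I g x.
  by split; [exact: cvgP fg|exact: derive_in_eq fg].
have gneq : \forall y \near within I x^', g y != g x.
  have : \forall y \near within I x^', diff_quotient g x y != 0.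
    exact: (cvgr_neq0 _ dg dg0).
  apply: filterS => y; apply: contra => /eqP gy.
  by rewrite /diff_quotient gy subrr mul0r.
have g_within : g @ within I x^' --> within I (g x)^'.
  move=> U UI; have {}UI : \forall z \near g x, z != g x -> I z -> U z by exact: UI.
  have gU : \forall y \near x, I y -> g y != g x -> I (g y) -> U (g y).
    exact: (derivable_in_continuous _ _ _ _ dg _ UI).
  have {}gU : \forall y \near within I x^', g y != g x -> I (g y) -> U (g y).
    change (\forall y \near x, y != x -> I y -> g y != g x -> I (g y) -> U (g y)).
    by apply: filterS gU => y + _.
  have II : \forall y \near within I x^', I y by exact: withinT.
  by apply: filterS3 gU gneq II => y + gy Iy; apply => //; exact: gI.
have : (fun y => diff_quotient f (g x) (g y) * diff_quotient g x y)
    @ within I x^' --> derive_in I f (g x) * derive_in I g x.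
  apply: cvgM => //; exact: (cvg_comp _ _ g_within df).
apply: cvg_trans; apply: near_eq_cvg.
apply: filterS gneq => y gy.
by rewrite /diff_quotient /= mulrA divfK// subr_eq0.
Qed.

(** At an interior point the restriction to I is immaterial near c, so the
    derivative within I is the two-sided one; this gives access to the classical
    mean value theorem. *)
Lemma derive_in_is_derive (R : realType) (I : set R) (g : R -> R) (a b c : R) :
  `[a, b] `<=` I -> c \in `]a, b[ -> derivable_in I g c ->
  is_derive c 1 g (derive_in I g c).
Proof.
move=> abI cab dg.
have shiftE : (fun h => h^-1 *: ((g \o shift c) (h *: 1) - g c)) =
              diff_quotient g c \o shift c.
  apply/funext => h; rewrite /diff_quotient /= addrK mulrC.
  by rewrite [h *: 1]mulr1 [h^-1 *: _]mulrC mulrC.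
have dgc : h^-1 *: ((g \o shift c) (h *: 1) - g c) @[h --> 0^'] -->
    derive_in I g c.
  rewrite shiftE => U gU.
  have {}gU : \forall y \near c, y != c -> I y -> U (diff_quotient g c y).
    exact: (dg _ gU).
  have II : \forall y \near c, I y.
    apply: filterS (near_in_itvoo cab) => y yab; apply: abI.
    exact: subset_itv_oo_cc yab.
  have : \forall y \near c, y != c -> U (diff_quotient g c y).
    by apply: filterS2 gU II => y + Iy yc; exact.
  rewrite (near_shift 0) subr0 => {}gU.
  change (\forall h \near 0, h != 0 -> U (diff_quotient g c (h + c))).
  apply: filterS gU => h /= + h0; apply.
  by rewrite -subr_eq0 addrK.
apply: DeriveDef; first exact: cvgP dgc.
exact: cvg_lim dgc.
Qed.

(** The location of the intermediate point is only recorded through its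
    distance to x, which treats x < y, y < x and x = y alike. *)
Lemma mean_value_in (R : realType) (I : set R) (g : R -> R) (x y : R) :
  is_interval I -> (forall z, I z -> derivable_in I g z) -> I x -> I y ->
  exists c, [/\ I c, `|c - x| <= `|y - x| &
    g y - g x = derive_in I g c * (y - x)].
Proof.
move=> I_itv dg.
have mvt u v : I u -> I v -> u < v -> exists2 c, u < c < v /\ I c &
    g v - g u = derive_in I g c * (v - u).
  move=> Iu Iv uv.
  have uvI : `[u, v] `<=` I.
    by move=> z /=; rewrite in_itv /=; exact: I_itv.
  have [c||c cuv gc] := @MVT R g (derive_in I g) u v uv.
  - move=> cuv; apply: (derive_in_is_derive _ _ _ _ _ _ uvI cuv).
    by apply/dg/uvI; exact: subset_itv_oo_cc cuv.
  - apply/subspace_continuousP => w uvw.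
    apply: cvg_trans (derivable_in_continuous _ _ _ _ (dg w (uvI _ uvw))).
    by apply: cvg_app; apply: within_subset uvI.
  - exists c => //; split; first by move: cuv; rewrite in_itv.
    by apply: uvI; exact: subset_itv_oo_cc cuv.
move=> Ix Iy; have [xy|yx|<-] := ltgtP x y.
- have [c [/andP[xc cy] Ic] gc] := mvt x y Ix Iy xy.
  by exists c; split => //; rewrite !ger0_norm; lra.
- have [c [/andP[yc cx] Ic] gc] := mvt y x Iy Ix yx.
  exists c; split => //; first by rewrite !ler0_norm; lra.
  by apply: oppr_inj; rewrite -mulrN !opprB.
- by exists x; rewrite !subrr mulr0.
Qed.

(** * Exponential growth and the orbit of a nearby point *)

(** The limsup is at most the supremum of every tail, so each tail has a term
    above any c smaller than the limsup.  The exponent may be infinite, in which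
    case any c does. *)
Lemma limn_esup_ln_gt0_growth (R : realType) (u : nat -> R) :
  (forall n, u n != 0) ->
  (0 < limn_esup (fun n : nat => ((n%:R^-1 : R)%:E * lne (`|u n|%:E))%E))%E ->
  exists2 c : R, 0 < c &
    forall N, exists2 n, (N <= n)%N & expR (c *+ n) < `|u n|.
Proof.
move=> u0; set v := fun n : nat => _ => v0.
have [c c0 cv] : exists2 c : R, 0 < c & (c%:E < limn_esup v)%E.
  case: (limn_esup v) v0 => [l| |]//.
  - rewrite lte_fin => l0; exists (l / 2); first lra.
    by rewrite lte_fin; lra.
  - by exists 1 => //; rewrite ltry.
exists c => // N.
(* The tail starts at N + 1 so that n > 0 and n^-1 is a true inverse. *)
have : (c%:E < ereal_sup (v @` [set n | (N.+1 <= n)%N]))%E.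
  apply: lt_le_trans cv _; apply: ereal_inf_lbound => /=.
  by exists [set n | (N.+1 <= n)%N] => //; exact: nbhs_infty_ge.
move=> /ereal_sup_gt[_ [n /= Nn <-]].
rewrite /v lne_EFin ?normr_gt0// -EFinM lte_fin => cn.
exists n; first exact: ltnW.
rewrite -[ltRHS]lnK ?posrE ?normr_gt0// ltr_expR -mulr_natr.
have n0 : (0 : R) < n%:R by rewrite ltr0n (leq_trans _ Nn).
by rewrite -ltr_pdivlMr// mulrC.
Qed.

Lemma iter_comp_self (R : realType) (I : set R) (f : nat -> R -> R) n :
  (forall n, set_fun I I (f n)) -> set_fun I I (iter_comp f n).
Proof.
by move=> fI; elim: n => [//|n IHn] x Ix; exact/fI/IHn.
Qed.

Lemma derive_in_iter_comp (R : realType) (I : set R) (f : nat -> R -> R)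
    (x : R) n :
  limit_point I x -> I x -> (forall n, set_fun I I (f n)) ->
  (forall n y, I y -> derivable_in I (f n) y) ->
  (forall n, derive_in I (f n) (iter_comp f n x) != 0) ->
  derivable_in I (iter_comp f n) x /\
  derive_in I (iter_comp f n) x =
    \prod_(k < n) derive_in I (f k) (iter_comp f k x).
Proof.
move=> lx Ix fI df f0; elim: n => [|n [dfn fnE]].
  have id1 : diff_quotient id x @ within I x^' --> (1 : R).
    have : cst (1 : R) @ within I x^' --> (1 : R).
      exact: (@cvg_cst _ _ _ (within I x^') _).
    apply: cvg_trans; apply: near_eq_cvg.
    change (\forall y \near x, y != x -> I y -> 1 = diff_quotient id x y).
    by near=> y => yx _; rewrite /diff_quotient divff// subr_eq0.
  rewrite big_ord0; split; first exact: cvgP id1.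
  exact: derive_in_eq id1.
have [] := @chain_rule_in R I (f n) (iter_comp f n) x => //.
- exact: iter_comp_self.
- by apply: df; exact: iter_comp_self.
- by rewrite fnE; apply/prodf_neq0 => k _; exact: f0.
- by move=> dfn1 fn1E; split => //; rewrite big_ord_recr/= mulrC -fnE.
Unshelve. all: by end_near. Qed.

(** At each step the factor f_k'(c) of the mean value theorem satisfies
    |f_k'(c)| >= |f_k'(x_k)| - m (1 - q) >= q |f_k'(x_k)|, because
    m <= |f_k'(x_k)|: the tolerance m (1 - q) is tuned for this. *)
Lemma orbit_gap_lower_bound (R : realType) (I : set R) (f : nat -> R -> R)
    (x y m q d : R) n :
  is_interval I -> (forall n, set_fun I I (f n)) ->
  (forall n z, I z -> derivable_in I (f n) z) -> I x -> I y -> 0 <= q <= 1 ->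
  (forall k, m <= `|derive_in I (f k) (iter_comp f k x)|) ->
  (forall k u v, I u -> I v -> `|u - v| <= d ->
    `|derive_in I (f k) u - derive_in I (f k) v| <= m * (1 - q)) ->
  (forall k, (k < n)%N -> `|iter_comp f k y - iter_comp f k x| <= d) ->
  q ^+ n * `|\prod_(k < n) derive_in I (f k) (iter_comp f k x)| * `|y - x|
    <= `|iter_comp f n y - iter_comp f n x|.
Proof.
move=> I_itv fI df Ix Iy /andP[q0 q1] mf f_osc; elim: n => [|n IHn] yx_close.
  by rewrite big_ord0 expr0 normr1 !mul1r.
have Ixn : I (iter_comp f n x) by exact: iter_comp_self.
have Iyn : I (iter_comp f n y) by exact: iter_comp_self.
have [c [Ic cx /= ->]] := mean_value_in _ _ _ _ _ I_itv (df n) Ixn Iyn.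
have := f_osc n _ _ Ixn Ic.
rewrite distrC => /(_ (le_trans cx (yx_close n (ltnSn n)))).
set a := derive_in I (f n) (iter_comp f n x); set b := derive_in I (f n) c.
move=> ab.
have qab : q * `|a| <= `|b|.
  have ma : m * (1 - q) <= `|a| * (1 - q).
    by apply: ler_wpM2r; [lra|exact: mf].
  have := le_trans (lerB_dist a b) ab; lra.
rewrite big_ord_recr exprS /= -/a !normrM.
set P := `|\prod_(k < n) _| in IHn *.
have -> : q * q ^+ n * (P * `|a|) * `|y - x| =
    (q * `|a|) * (q ^+ n * P * `|y - x|) by ring.
apply: ler_pM => //; first exact: mulr_ge0.
- by rewrite !mulr_ge0 ?exprn_ge0 ?normr_ge0.
- by apply: IHn => k kn; exact/yx_close/ltnW.
Qed.

Theorem theorem3p1 (R : realType) (I : set R) (f : nat -> R -> R) (x0 : R)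
    (I_itv : is_interval I)
    (I_nondeg : exists a b : R, [/\ I a, I b & a < b])
    (f_self : forall n : nat, set_fun I I (f n))
    (f_C1 : forall n : nat, C1_in I (f n))
    (x0_in : I x0)
    (f'_equi : equi_continuous I (fun n : nat => derive_in I (f n)))
    (M_gt0 : 0 < inf [set r : R | exists n k : nat,
                        r = `|derive_in I (f n) (iter_comp f k x0)|])
    (lambda_gt0 : (0 < lyapunov_exponent I f x0)%E) :
  strongly_sensitive_at I f x0.
Proof.
have x0_lim : limit_point I x0 by exact: interval_limit_point.
have df n z : I z -> derivable_in I (f n) z by exact: (f_C1 n).1.
set M := inf _ in M_gt0.
have Mf n k : M <= `|derive_in I (f n) (iter_comp f k x0)|.
  apply: ge_inf; last by exists n, k.
  by exists 0 => _ [i [j ->]].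
have f'0 n : derive_in I (f n) (iter_comp f n x0) != 0.
  by rewrite -normr_gt0 (lt_le_trans M_gt0).
have Dn n := derive_in_iter_comp _ _ _ _ n x0_lim x0_in f_self df f'0.
have D0 n : derive_in I (iter_comp f n) x0 != 0.
  by rewrite (Dn n).2; apply/prodf_neq0 => k _; exact: f'0.
have [c c0 cD] := limn_esup_ln_gt0_growth _ _ D0 lambda_gt0.
(* Losing a factor q at each step halves the growth rate c. *)
pose q := expR (- (c / 2)).
have q1 : q < 1 by rewrite expR_lt1; lra.
have q01 : 0 <= q <= 1 by rewrite expR_ge0 ltW.
have Mq_gt0 : 0 < M * (1 - q) by rewrite mulr_gt0// subr_gt0.
have [d d0 f'd] := f'_equi _ Mq_gt0.
split => //.
  move=> x0_iso; have /disj_setPS/(_ x0)/= := disjoint_isolated_limit_point I.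
  exact.
(* Equicontinuity is available at distance < d, while orbits that are not
   separated stay at distance <= delta only: hence delta = d / 2. *)
exists (d / 2); first lra.
exists (I `&` ball x0 (d / 2)); split; first exact: subIsetl.
  have : \forall y \near x0, ball x0 (d / 2) y.
    by apply: nbhsx_ballx; lra.
  by apply: filterS => y ? ?; split.
move=> y0 [Iy0]; rewrite /ball /= distrC => y0x0 y0neq; apply: contrapT => no_exit.
have close k : `|iter_comp f k y0 - iter_comp f k x0| <= d / 2.
  (* Time 0 does not count as a separation; U takes care of it. *)
  case: k => [|k]; first exact: ltW.
  by rewrite leNgt; apply/negP => exit; apply: no_exit; exists k.+1.
have f'd2 k u v : I u -> I v -> `|u - v| <= d / 2 ->
    `|derive_in I (f k) u - derive_in I (f k) v| <= M * (1 - q).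
  by move=> Iu Iv uv; apply/ltW/f'd => //; lra.
have y0x0_gt0 : 0 < `|y0 - x0| by rewrite normr_gt0 subr_eq0.
(* From time N on, (c / 2) n |y0 - x0| exceeds d / 2. *)
pose N := (Num.truncn (d / 2 / `|y0 - x0| / (c / 2))).+1.
have [n Nn cDn] := cD N.
have := orbit_gap_lower_bound _ _ _ _ _ _ _ _ n I_itv f_self df x0_in Iy0
  q01 (fun k => Mf k k) f'd2 (fun k _ => close k).
rewrite -(Dn n).2 => /le_trans/(_ (close n)); apply/negP; rewrite -ltNge.
(* The bound exp(c n / 2) >= 1 + c n / 2 already diverges. *)
have growth : c / 2 *+ n < q ^+ n * `|derive_in I (iter_comp f n) x0|.
  apply: (@lt_trans _ _ (q ^+ n * expR (c *+ n))).
    have -> : q ^+ n * expR (c *+ n) = expR (c / 2 *+ n).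
      rewrite -[c *+ n]mulr_natl -[c / 2 *+ n]mulr_natl -expRM_natl -expRD.
      by rewrite -mulrDr; congr (expR (_ * _)); lra.
    by apply: lt_le_trans (expR_ge1Dx _); rewrite ltrDr.
  by rewrite ltr_pM2l// exprn_gt0// expR_gt0.
rewrite -ltr_pdivrMr//; apply: lt_trans growth.
rewrite -[ltRHS]mulr_natl -ltr_pdivrMr; last lra.
by apply: lt_le_trans (truncnS_gt _) _; rewrite ler_nat.
Qed.
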